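(* Let $\mathcal{B}$ be a connected small category, let $X:\mathcal{B}\to\mathcal{G}$ be a grading of $\mathcal{B}$ that is bijective on objects, and let $x_0$ be an object of $\mathcal{G}$. Then the smash product $\mathcal{B}\#_{x_0}X$ is connected if and only if $X$ is effective.
   Context: All categories (and groupoids) are small. A category is connected if its underlying undirected graph has one connected component. The set of morphisms from $x$ to $y$ in a category $\mathcal{A}$ is denoted ${}_y\mathcal{A}_x$. Fundamental groupoid: $Q\mathcal{B}$ is the category of fractions obtained from $\mathcal{B}$ by formally inverting all morphisms: a groupoid with the same objects as $\mathcal{B}$, with a canonical functor $Q_{\mathcal{B}}:\mathcal{B}\to Q\mathcal{B}$, the identity on objects, such that any functor $F:\mathcal{B}\to\mathcal{C}$ sending every morphism to an invertible morphism factors uniquely as $F=F'Q_{\mathcal{B}}$. A grading of $\mathcal{B}$ is a functor $X:\mathcal{B}\to\mathcal{G}$ to a groupoid $\mathcal{G}$; $QX:Q\mathcal{B}\to\mathcal{G}$ denotes the unique functor with $(QX)Q_{\mathcal{B}}=X$. The grading $X$ is effective if $\mathcal{G}$ is connected, $X$ is bijective on objects, and $QX$ is full. Smash product: the category $\mathcal{B}\#_{x_0}X$ has as objects the pairs $(b,\gamma)$ with $b$ an object of $\mathcal{B}$ and $\gamma\in{}_{x_0}\mathcal{G}_{Xb}$; a morphism from $(b,\gamma)$ to $(c,\delta)$ is a morphism $f\in{}_c\mathcal{B}_b$ with $\delta X(f)=\gamma$; composition is that of $\mathcal{B}$. *)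

(* Defs.v *)
From Stdlib Require Import Relation_Operators.
From HB Require Import structures.
From mathcomp Require Import all_boot boolp.

Set Implicit Arguments.
Unset Strict Implicit.
Unset Printing Implicit Defensive.

(* [hom x y] is the set of morphisms from x to y, and [comp g f] is "g after
   f". Equality of morphisms is Leibniz equality. *)
Record category := Category {
  ob :> Type;
  hom : ob -> ob -> Type;
  idm : forall x, hom x x;
  comp : forall x y z, hom y z -> hom x y -> hom x z;
  comp_idl : forall x y (f : hom x y), comp (idm y) f = f;
  comp_idr : forall x y (f : hom x y), comp f (idm x) = f;
  comp_assoc : forall x y z t (h : hom z t) (g : hom y z) (f : hom x y),
    comp h (comp g f) = comp (comp h g) f
}.

Arguments hom {c} x y.
Arguments idm {c} x.
Arguments comp {c x y z} g f.

Definition is_inverse (C : category) (x y : C) (f : hom x y) (g : hom y x) :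
  Prop := comp g f = idm x /\ comp f g = idm y.

Definition invertible (C : category) (x y : C) (f : hom x y) : Prop :=
  exists g, is_inverse f g.

Record groupoid := Groupoid {
  gcat :> category;
  groupoid_inv : forall (x y : gcat) (f : hom x y), invertible f
}.

Record functor (B C : category) := Functor {
  fob :> B -> C;
  fmap : forall x y : B, hom x y -> hom (fob x) (fob y);
  fmap_id : forall x, fmap (idm x) = idm (fob x);
  fmap_comp : forall x y z (g : hom y z) (f : hom x y),
    fmap (comp g f) = comp (fmap g) (fmap f)
}.

Arguments fmap {B C} f {x y} u : rename.

Definition fcomp (B C D : category) (G : functor C D) (F : functor B C) :
  functor B D.
Proof.
refine (@Functor B D (fun x => G (F x)) (fun x y f => fmap G (fmap F f)) _ _).
- by move=> x; rewrite !fmap_id.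
- by move=> x y z g f; rewrite !fmap_comp.
Defined.

Definition full (B C : category) (F : functor B C) : Prop :=
  forall (x y : B) (g : hom (F x) (F y)), exists f : hom x y, fmap F f = g.

Definition bijective_on_objects (B C : category) (F : functor B C) : Prop :=
  bijective (fob F).

Definition adjacent (C : category) (x y : C) : Prop :=
  inhabited (hom x y) \/ inhabited (hom y x).

(* Exactly one connected component: the empty category is not connected. *)
Definition connected (C : category) : Prop :=
  inhabited C /\ forall x y : C, clos_refl_trans C (@adjacent C) x y.

Definition grading (B : category) (G : groupoid) := functor B G.

(* The category of fractions inverting all morphisms of B: morphisms are
   zigzags of morphisms of B, modulo the congruence [zz_eq]. In [zz_fwd f w] and
   [zz_bwd f w] the zigzag w is travelled first. *)
Section Fractions.
Variable B : category.

Inductive zigzag (x : B) : B -> Type :=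
| zz_nil : zigzag x x
| zz_fwd y z (f : hom y z) (w : zigzag x y) : zigzag x z
| zz_bwd y z (f : hom z y) (w : zigzag x y) : zigzag x z.

Fixpoint zz_cat (x y z : B) (v : zigzag y z) (w : zigzag x y) : zigzag x z :=
  match v in zigzag _ t return zigzag x t with
  | zz_nil => w
  | zz_fwd _ _ f v' => zz_fwd f (zz_cat v' w)
  | zz_bwd _ _ f v' => zz_bwd f (zz_cat v' w)
  end.

Inductive zz_eq (x : B) : forall y : B, zigzag x y -> zigzag x y -> Prop :=
| zz_refl y (w : zigzag x y) : zz_eq w w
| zz_sym y (v w : zigzag x y) : zz_eq v w -> zz_eq w v
| zz_trans y (u v w : zigzag x y) : zz_eq u v -> zz_eq v w -> zz_eq u w
| zz_congr_fwd y z (f : hom y z) (v w : zigzag x y) :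
    zz_eq v w -> zz_eq (zz_fwd f v) (zz_fwd f w)
| zz_congr_bwd y z (f : hom z y) (v w : zigzag x y) :
    zz_eq v w -> zz_eq (zz_bwd f v) (zz_bwd f w)
| zz_id y (w : zigzag x y) : zz_eq (zz_fwd (idm y) w) w
| zz_comp y z t (g : hom z t) (f : hom y z) (w : zigzag x y) :
    zz_eq (zz_fwd (comp g f) w) (zz_fwd g (zz_fwd f w))
| zz_bwd_fwd y z (f : hom y z) (w : zigzag x y) :
    zz_eq (zz_bwd f (zz_fwd f w)) w
| zz_fwd_bwd y z (f : hom z y) (w : zigzag x y) :
    zz_eq (zz_fwd f (zz_bwd f w)) w.

HB.instance Definition _ (x y : B) := gen_eqMixin (zigzag x y).
HB.instance Definition _ (x y : B) := gen_choiceMixin (zigzag x y).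

Definition zz_eqb (x y : B) : rel (zigzag x y) := fun v w => `[< zz_eq v w >].

Lemma zz_eqb_refl x y : reflexive (@zz_eqb x y).
Proof. by move=> w; apply/asboolP/zz_refl. Qed.

Lemma zz_eqb_sym x y : symmetric (@zz_eqb x y).
Proof. by move=> v w; apply/asboolP/asboolP => /zz_sym. Qed.

Lemma zz_eqb_trans x y : transitive (@zz_eqb x y).
Proof.
by move=> v u w /asboolP uv /asboolP vw; apply/asboolP/(zz_trans uv).
Qed.

Canonical zz_equiv (x y : B) : equiv_rel (zigzag x y) :=
  EquivRel (@zz_eqb x y) (@zz_eqb_refl x y) (@zz_eqb_sym x y)
    (@zz_eqb_trans x y).

Local Open Scope quotient_scope.

Definition qhom (x y : B) : Type := {eq_quot zz_equiv x y}.

Definition zz_class (x y : B) (w : zigzag x y) : qhom x y :=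
  \pi_({eq_quot zz_equiv x y}) w.

Definition zz_repr (x y : B) (f : qhom x y) : zigzag x y :=
  repr (f : {eq_quot zz_equiv x y}).

Lemma zz_reprK x y (f : qhom x y) : zz_class (zz_repr f) = f.
Proof. exact: reprK. Qed.

Lemma zz_classP x y (v w : zigzag x y) : zz_class v = zz_class w <-> zz_eq v w.
Proof.
by split=> [/eqquotP /asboolP|vw] //; apply/eqquotP/asboolP.
Qed.

Lemma zz_repr_class x y (w : zigzag x y) : zz_eq (zz_repr (zz_class w)) w.
Proof. by apply/zz_classP; rewrite zz_reprK. Qed.

Lemma zz_cat_nilr x y (w : zigzag x y) : zz_cat w (zz_nil x) = w.
Proof. by elim: w => //= y' z f w ->. Qed.

Lemma zz_catA x y z t (u : zigzag z t) (v : zigzag y z) (w : zigzag x y) :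
  zz_cat u (zz_cat v w) = zz_cat (zz_cat u v) w.
Proof. by elim: u => //= a b f u ->. Qed.

Lemma zz_cat_eq x y z (v v' : zigzag y z) (w w' : zigzag x y) :
  zz_eq v v' -> zz_eq w w' -> zz_eq (zz_cat v w) (zz_cat v' w').
Proof.
move=> vv' ww'; apply: (@zz_trans _ _ _ (zz_cat v w')).
  elim: v {v' vv'} => //= a b f v IH; first exact: zz_congr_fwd.
  exact: zz_congr_bwd.
elim: vv' => /=; move=> *; by [exact: zz_refl | exact: zz_sym
  | apply: zz_trans; eassumption | exact: zz_congr_fwd | exact: zz_congr_bwd
  | exact: zz_id | exact: zz_comp | exact: zz_bwd_fwd | exact: zz_fwd_bwd].
Qed.

Definition qcomp (x y z : B) (g : qhom y z) (f : qhom x y) : qhom x z :=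
  zz_class (zz_cat (zz_repr g) (zz_repr f)).

Lemma qcomp_class x y z (v : zigzag y z) (w : zigzag x y) :
  qcomp (zz_class v) (zz_class w) = zz_class (zz_cat v w).
Proof. by apply/zz_classP/zz_cat_eq; apply: zz_repr_class. Qed.

Definition fraction_category : category.
Proof.
refine (@Category B qhom (fun x => zz_class (zz_nil x)) qcomp _ _ _).
- by move=> x y f; rewrite -(zz_reprK f) qcomp_class.
- by move=> x y f; rewrite -(zz_reprK f) qcomp_class zz_cat_nilr.
- move=> x y z t h g f; rewrite -(zz_reprK h) -(zz_reprK g) -(zz_reprK f).
  by rewrite !qcomp_class zz_catA.
Defined.

Definition qfun : functor B fraction_category.
Proof.
refine (@Functor B fraction_category (fun x => x)
  (fun x y f => zz_class (zz_fwd f (zz_nil x))) _ _).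
- by move=> x; apply/zz_classP/zz_id.
- by move=> x y z g f /=; rewrite qcomp_class; apply/zz_classP/zz_comp.
Defined.

Definition qbwd (x y : B) (f : hom x y) : @hom fraction_category y x :=
  zz_class (zz_bwd f (zz_nil y)).

Lemma qbwdP x y (f : hom x y) : is_inverse (fmap qfun f) (qbwd f).
Proof.
split; rewrite /= qcomp_class; apply/zz_classP; first exact: zz_bwd_fwd.
exact: zz_fwd_bwd.
Qed.

Lemma fraction_category_inv (x y : fraction_category) (f : hom x y) :
  invertible f.
Proof.
rewrite -(zz_reprK f); elim: (zz_repr f) => {y f} [|y z f w|y z f w].
- by exists (idm x); split; apply: comp_idl.
- case=> g [gw wg].
  have -> : zz_class (zz_fwd f w) = comp (fmap qfun f) (zz_class w).
    by rewrite /= qcomp_class.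
  have [bf fb] := qbwdP f.
  exists (comp g (qbwd f)); split.
    by rewrite comp_assoc -(comp_assoc g) bf comp_idr gw.
  by rewrite comp_assoc -(comp_assoc (fmap qfun f)) wg comp_idr fb.
- case=> g [gw wg].
  have -> : zz_class (zz_bwd f w) = comp (qbwd f) (zz_class w).
    by rewrite /qbwd /= qcomp_class.
  have [bf fb] := qbwdP f.
  exists (comp g (fmap qfun f)); split.
    by rewrite comp_assoc -(comp_assoc g) fb comp_idr gw.
  by rewrite comp_assoc -(comp_assoc (qbwd f)) wg comp_idr bf.
Qed.

Definition fundamental_groupoid : groupoid := Groupoid fraction_category_inv.

End Fractions.

Section Lift.
Variables (B C : category) (F : functor B C).
Hypothesis invF : forall (x y : B) (f : hom x y), invertible (fmap F f).

Definition finv (x y : B) (f : hom x y) : hom (F y) (F x) :=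
  projT1 (cid (invF f)).

Lemma finvP x y (f : hom x y) : is_inverse (fmap F f) (finv f).
Proof. exact: projT2 (cid (invF f)). Qed.

Fixpoint zz_eval (x y : B) (w : zigzag x y) : hom (F x) (F y) :=
  match w in zigzag _ t return hom (F x) (F t) with
  | zz_nil => idm (F x)
  | zz_fwd _ _ f w' => comp (fmap F f) (zz_eval w')
  | zz_bwd _ _ f w' => comp (finv f) (zz_eval w')
  end.

Lemma zz_eval_eq x y (v w : zigzag x y) : zz_eq v w -> zz_eval v = zz_eval w.
Proof.
elim=> {y v w} //=.
- by move=> y u v w _ -> _ ->.
- by move=> y z f v w _ ->.
- by move=> y z f v w _ ->.
- by move=> y w; rewrite fmap_id comp_idl.
- by move=> y z t g f w; rewrite fmap_comp comp_assoc.
- by move=> y z f w; rewrite comp_assoc (finvP f).1 comp_idl.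
- by move=> y z f w; rewrite comp_assoc (finvP f).2 comp_idl.
Qed.

Lemma zz_eval_cat x y z (v : zigzag y z) (w : zigzag x y) :
  zz_eval (zz_cat v w) = comp (zz_eval v) (zz_eval w).
Proof.
by elim: v => /= [|a b f v ->|a b f v ->]; rewrite ?comp_idl ?comp_assoc.
Qed.

Definition qlift : functor (fundamental_groupoid B) C.
Proof.
refine (@Functor (fundamental_groupoid B) C (fob F)
  (fun x y f => zz_eval (zz_repr f)) _ _).
- by move=> x; rewrite (zz_eval_eq (zz_repr_class _)).
- move=> x y z g f.
  by rewrite (zz_eval_eq (zz_repr_class _)) zz_eval_cat.
Defined.

Lemma qlift_class (x y : B) (w : zigzag x y) :
  @fmap _ _ qlift x y (zz_class w) = zz_eval w.
Proof. exact/zz_eval_eq/zz_repr_class. Qed.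

End Lift.

Lemma functor_ext (B C : category) (o : B -> C) m m' i i' c c' :
  (forall x y (f : hom x y), m x y f = m' x y f) ->
  @Functor B C o m i c = @Functor B C o m' i' c'.
Proof.
move=> mm'; have {mm'}E : m = m'.
  apply: functional_extensionality_dep => x.
  apply: functional_extensionality_dep => y.
  exact: functional_extensionality_dep (mm' x y).
by subst m'; rewrite (Prop_irrelevance i i') (Prop_irrelevance c c').
Qed.

Lemma inverse_unique (C : category) (x y : C) (f : hom x y) (g h : hom y x) :
  is_inverse f g -> is_inverse f h -> g = h.
Proof.
by case=> gf _ [_ fh]; rewrite -[g]comp_idr -fh comp_assoc gf comp_idl.
Qed.

Lemma qlift_qfun (B C : category) (F : functor B C)
    (invF : forall (x y : B) (f : hom x y), invertible (fmap F f)) :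
  fcomp (qlift invF) (qfun B) = F.
Proof.
case: F invF => o m i c invF; apply: functor_ext => x y f.
by rewrite qlift_class /= comp_idr.
Qed.

Lemma fundamental_groupoid_universal (B C : category) (F : functor B C) :
  (forall (x y : B) (f : hom x y), invertible (fmap F f)) ->
  exists! F' : functor (fundamental_groupoid B) C, F = fcomp F' (qfun B).
Proof.
move=> invF; exists (qlift invF); split; first by rewrite qlift_qfun.
move=> G FG; subst F; case: G invF => o m i c invF.
apply: functor_ext => x y f; rewrite -[in RHS](zz_reprK f).
elim: (zz_repr f) => {y f} /= [|y z f w ->|y z f w ->]; first by rewrite i.
  rewrite (_ : zz_class (zz_fwd f w) =
    @comp (fraction_category B) _ _ _ (fmap (qfun B) f) (zz_class w)) ?c //.
  by rewrite /= qcomp_class.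
rewrite (_ : zz_class (zz_bwd f w) =
  @comp (fraction_category B) _ _ _ (qbwd f) (zz_class w)) ?c; last first.
  by rewrite /qbwd /= qcomp_class.
congr comp; apply: inverse_unique (finvP invF f) _.
have [bf fb] := qbwdP f.
by split; rewrite /= -c ?bf ?fb i.
Qed.

(* The functor QX: the unique one with [fcomp (grading_lift X) (qfun B) = X]. *)
Definition grading_lift (B : category) (G : groupoid) (X : grading B G) :
  functor (fundamental_groupoid B) G :=
  qlift (fun x y (f : hom x y) => groupoid_inv (fmap X f)).

Lemma grading_lift_qfun (B : category) (G : groupoid) (X : grading B G) :
  fcomp (grading_lift X) (qfun B) = X.
Proof. exact: qlift_qfun. Qed.

Definition effective (B : category) (G : groupoid) (X : grading B G) : Prop :=
  [/\ connected G, bijective_on_objects X & full (grading_lift X)].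

Section Smash.
Variables (B : category) (G : groupoid) (X : grading B G) (x0 : G).

Definition smash_ob : Type := {b : B & hom (X b) x0}.

Definition smash_hom (s t : smash_ob) : Type :=
  {f : hom (projT1 s) (projT1 t) | comp (projT2 t) (fmap X f) = projT2 s}.

Lemma smash_hom_ext s t (f g : smash_hom s t) : sval f = sval g -> f = g.
Proof.
case: f g => [f fP] [g gP] /= fg; subst g.
by rewrite (Prop_irrelevance fP gP).
Qed.

Definition smash_id (s : smash_ob) : smash_hom s s.
Proof.
by exists (idm (projT1 s)); rewrite fmap_id comp_idr.
Defined.

Definition smash_comp (s t u : smash_ob) (g : smash_hom t u)
  (f : smash_hom s t) : smash_hom s u.
Proof.
exists (comp (sval g) (sval f)).
by rewrite fmap_comp comp_assoc (svalP g) (svalP f).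
Defined.

Definition smash : category.
Proof.
refine (@Category smash_ob smash_hom smash_id smash_comp _ _ _).
- by move=> s t f; apply/smash_hom_ext/comp_idl.
- by move=> s t f; apply/smash_hom_ext/comp_idr.
- by move=> s t u v h g f; apply/smash_hom_ext/comp_assoc.
Defined.

End Smash.

(* Main.v *)
(* A path from (b, g) to (c, d) in the smash product is the same thing as a
   zigzag w from b to c in B with d (QX)(w) = g. Given u : X b -> X c and any
   d : X c -> x0, a path from (b, d u) to (c, d) thus amounts to a lift of u
   along QX. *)
From Stdlib Require Import Relation_Operators.
From mathcomp Require Import all_boot.
Require Import Defs.

Set Implicit Arguments.
Unset Strict Implicit.
Unset Printing Implicit Defensive.

Lemma connected_zigzag (C : category) (x y : C) :
  clos_refl_trans C (@adjacent C) x y -> inhabited (zigzag x y).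
Proof.
elim=> {x y} [x y [[f]|[f]]|x|x y z _ [v] _ [w]].
- exact: inhabits (zz_fwd f (zz_nil x)).
- exact: inhabits (zz_bwd f (zz_nil x)).
- exact: inhabits (zz_nil x).
- exact: inhabits (zz_cat w v).
Qed.

Lemma groupoid_cancel_l (G : groupoid) (x y z : G) (g : hom y z)
    (f f' : hom x y) : comp g f = comp g f' -> f = f'.
Proof.
have [h [hg _]] := groupoid_inv g => gf.
by rewrite -[f]comp_idl -hg -comp_assoc gf comp_assoc hg comp_idl.
Qed.

Section Smash.
Variables (B : category) (G : groupoid) (X : grading B G) (x0 : G).

Let invX (x y : B) (f : hom x y) := groupoid_inv (fmap X f).

(** Induction on [w] with [d] free: the last arrow [f] of [w] dictates the component at the vertex
    before it, [d X(f)] if [f] is travelled forwards and [d X(f)^-1] if backwards. *)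
Lemma smash_path_of_zigzag (x y : B) (w : zigzag x y) (g : hom (X x) x0)
    (d : hom (X y) x0) :
  comp d (zz_eval invX w) = g ->
  clos_refl_trans (smash X x0) (@adjacent (smash X x0))
    (existT _ x g) (existT _ y d).
Proof.
elim: w d => {y} [|y z f w IH|y z f w IH] d;
  rewrite [zz_eval _ _]/= => dw.
- by rewrite -dw comp_idr; apply: rt_refl.
- apply: rt_trans (IH (comp d (fmap X f)) _) _; first by rewrite -comp_assoc.
  by apply: rt_step; left; split; exists f.
- apply: rt_trans (IH (comp d (finv invX f)) _) _; first by rewrite -comp_assoc.
  apply: rt_step; right; split; exists f => /=.
  by rewrite -comp_assoc (finvP invX f).1 comp_idr.
Qed.

(** Each edge projects to a one-arrow zigzag, forward or backward, and chaining paths becomes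
    concatenation. *)
Lemma zigzag_of_smash_path (s t : smash X x0) :
  clos_refl_trans (smash X x0) (@adjacent (smash X x0)) s t ->
  exists w : zigzag (projT1 s) (projT1 t),
    comp (projT2 t) (zz_eval invX w) = projT2 s.
Proof.
elim=> {s t} [s t [[[f fP]]|[[f fP]]]|s|s t u _ [v vP] _ [w wP]].
- by exists (zz_fwd f (zz_nil _)); rewrite /= comp_idr.
- exists (zz_bwd f (zz_nil _)); rewrite /= comp_idr -fP -comp_assoc.
  by rewrite (finvP invX f).2 comp_idr.
- by exists (zz_nil _); rewrite /= comp_idr.
- by exists (zz_cat w v); rewrite zz_eval_cat comp_assoc wP.
Qed.

End Smash.

Theorem proposition4p7 (B : category) (G : groupoid) (X : grading B G)
  (x0 : G) (hB : connected B) (hX : bijective_on_objects X) :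
  connected (smash X x0) <-> effective X.
Proof.
have surjX (x : G) : exists b, X b = x.
  by have [Y _ YK] := hX; exists (Y x).
(* Arrows travelled backwards are inverted in [G], so a zigzag in [B] evaluates to a morphism
   there. *)
have homX (b c : B) : inhabited (hom (X b) (X c)).
  have [w] := connected_zigzag (hB.2 b c).
  exact: inhabits (zz_eval (fun x y f => groupoid_inv (fmap X f)) w).
(* With the base point in the form [X b0], [homX] supplies morphisms into it. *)
have [b0 Xb0] := surjX x0; subst x0.
split=> [[_ conn]|[_ _ fullX]].
  split=> //.
    split=> [|x y]; first exact: inhabits (X b0).
    have [b <-] := surjX x; have [c <-] := surjX y.
    by apply: rt_step; left; apply: homX.
  (* A path from [(x, d g)] to [(y, d)] yields [w] with [d (QX)(w) = d g], and [d] cancels in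
     [G]. *)
  move=> x y g; have [d] := homX y b0.
  have [w wP] := zigzag_of_smash_path
    (conn (existT _ x (comp d g)) (existT _ y d)).
  exists (zz_class w); apply: (groupoid_cancel_l (g := d)).
  by rewrite qlift_class.
split; first by apply: inhabits; exists b0; exact: idm.
move=> [b g] [c d]; have [e [_ de]] := groupoid_inv d.
(* Since [e] inverts [d], a lift [q] of [e g] satisfies [d (QX)(q) = g]. *)
have [q qP] := fullX b c (comp e g).
apply: (smash_path_of_zigzag (w := zz_repr q)).
(* The value of [zz_eval] at the representative of [q] is [(QX)(q)] by conversion, so [qP]
   applies. *)
by rewrite [zz_eval _ _]qP comp_assoc de comp_idl.
Qed.
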